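(* Let $\mathcal{H}$ be a real Hilbert space, let $T_i\colon\mathcal{H}\to\mathcal{H}$ be $\rho_i$-strongly quasinonexpansive for $i\in\{1,\dots,n\}$, and let $T:=T_n\cdots T_2T_1$ (composition). Assume that $\operatorname{Fix}T=\bigcap_{i=1}^n\operatorname{Fix}T_i\neq\emptyset$ and denote $U=\mathbb{B}(z,R)$ for some $z\in\operatorname{Fix}T$ and $R>0$. Suppose that the following assertions hold. (i) The operator $T_i$ is Hölder regular on $U$ for all $i\in\{1,\dots,n\}$. (ii) The collection $\{\operatorname{Fix}T_i\}_{i=1}^n$ is Hölder regular on $U$. Then $T$ is Hölder regular on $U$.
   Context: $\operatorname{Fix}S=\{u\in\mathcal{H}:S(u)=u\}$, $\operatorname{d}(y,C)=\inf_{c\in C}\|y-c\|$, and $\mathbb{B}(z,R)=\{x\in\mathcal{H}:\|x-z\|\leq R\}$. An operator $S\colon\mathcal{H}\to\mathcal{H}$ is $\rho$-strongly quasinonexpansive ($\rho$-SQNE) if $\rho>0$ and $\|S(x)-x^*\|^2+\rho\|x-S(x)\|^2\leq\|x-x^*\|^2$ for all $x\in\mathcal{H}$ and all $x^*\in\operatorname{Fix}S$. An operator $S\colon\mathcal{H}\to\mathcal{H}$ is Hölder regular on $U\subseteq\mathcal{H}$ if there exist $\kappa>0$ and $\gamma\in(0,1)$ such that $\operatorname{d}(y,\operatorname{Fix}S)\leq\kappa\|y-S(y)\|^{\gamma}$ for all $y\in U$. A collection of sets $\{C_1,\dots,C_n\}$ in $\mathcal{H}$ is Hölder regular on $U$ if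 there exist $\tau>0$ and $\theta\in(0,1)$ such that $\operatorname{d}(x,\bigcap_{i=1}^nC_i)\leq\tau\max_{i=1,\dots,n}\operatorname{d}(x,C_i)^{\theta}$ for all $x\in U$. *)

(* Defs.v *)
From HB Require Import structures.
From mathcomp Require Import all_boot all_order all_algebra.
From mathcomp Require Import all_classical all_reals all_analysis.
Import Order.TTheory GRing.Theory Num.Theory.
Import numFieldNormedType.Exports.

Set Implicit Arguments.
Unset Strict Implicit.
Unset Printing Implicit Defensive.

Local Open Scope classical_set_scope.
Local Open Scope ring_scope.

Definition Fix (X : Type) (S : X -> X) : set X := [set u | S u = u].

(* [inf] is real-valued, with the junk value 0 on the empty set: [dist y C] is
   meaningful only for nonempty [C]. *)
Definition dist (R : realType) (H : normedModType R) (y : H) (C : set H) : R :=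
  inf [set `|y - c| | c in C].

Definition strongly_quasinonexpansive (R : realType) (H : normedModType R)
    (rho : R) (S : H -> H) : Prop :=
  0 < rho /\
  forall x xs : H, Fix S xs ->
    `|S x - xs| ^+ 2 + rho * `|x - S x| ^+ 2 <= `|x - xs| ^+ 2.

Definition holder_regular_op (R : realType) (H : normedModType R)
    (S : H -> H) (U : set H) : Prop :=
  exists kappa gamma : R, [/\ 0 < kappa, 0 < gamma < 1 &
    forall y, U y -> dist y (Fix S) <= kappa * `|y - S y| `^ gamma].

(* The maximum is taken of nonnegative reals, so starting it at 0 is harmless
   when [n > 0]. *)
Definition holder_regular_sets (R : realType) (H : normedModType R) (n : nat)
    (C : 'I_n -> set H) (U : set H) : Prop :=
  exists tau theta : R, [/\ 0 < tau, 0 < theta < 1 &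
    forall x, U x ->
      dist x (\bigcap_i C i) <=
      tau * \big[Num.max/0]_(i < n) (dist x (C i) `^ theta)].

(* T_(n-1) \o ... \o T_1 \o T_0: [enum 'I_n] is increasing, so T_0 acts first. *)
Definition comp_ops (X : Type) (n : nat) (T : 'I_n -> X -> X) : X -> X :=
  fun x => foldl (fun y i => T i y) x (enum 'I_n).

(* Main.v *)
(** Write [e x = `|x - T x|].  Fejer monotonicity with respect to the common
    fixed point [z] telescopes: each intermediate step [`|y - T_i y|] satisfies
    [rho_i * `|y - T_i y|^2 <= `|x - z|^2 - `|T x - z|^2 <= 2 r e x], hence is
    bounded by a constant times a power of [e] on the ball.  Such bounds are
    stable under sums, maxima and powers (because [e] is bounded on the ball),
    so they pass to [`|x - y|], to [d(x, Fix T_i) <= `|x - y| + d(y, Fix T_i)]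
    and finally, by regularity of the sets, to [d(x, Fix T)]. *)
Require Import Defs.
From HB Require Import structures.
From mathcomp Require Import all_boot all_order all_algebra.
From mathcomp Require Import all_classical all_reals all_analysis.
From mathcomp Require Import lra.
Import Order.TTheory GRing.Theory Num.Theory.
Import numFieldNormedType.Exports.

Local Open Scope classical_set_scope.
Local Open Scope ring_scope.

Section PowerBound.
Context {R : realType} {X : Type}.

(** With [f] the distance to [Fix S] and [e] the residual of [S], this unfolds to Hölder regularity
    of [S] on [U], so the final goal is itself of this form. *)
Definition power_bounded (U : set X) (e f : X -> R) : Prop :=
  exists C a : R, [/\ 0 < C, 0 < a < 1 &
    forall x, U x -> f x <= C * e x `^ a].

(** On a bounded range an exponent can be lowered at the cost of a constant, since the surplus
    factor [t]^ (b - a)[is at most]M [^ (b - a)]. *)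
Lemma powR_le_exponent {M t a b : R} : 0 <= t <= M -> 0 < a <= b ->
  t `^ b <= M `^ (b - a) * t `^ a.
Proof.
move=> /andP[t0 tM] /andP[a0 ab].
have -> : t `^ b = t `^ (b - a) * t `^ a.
  by rewrite -powRD subrK // (gt_eqF (lt_le_trans a0 ab)).
by rewrite ler_wpM2r ?powR_ge0 // ge0_ler_powR ?subr_ge0 ?nnegrE// (le_trans t0).
Qed.

Context {U : set X} {e : X -> R} {M : R}.
Hypotheses (M_gt0 : 0 < M) (e_bounded : forall x, U x -> 0 <= e x <= M).

Lemma power_bounded_le {f g : X -> R} : power_bounded U e g ->
  (forall x, U x -> f x <= g x) -> power_bounded U e f.
Proof.
move=> [C [a [C0 a01 gC]]] fg; exists C, a; split => // x Ux.
exact: le_trans (fg x Ux) (gC x Ux).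
Qed.

Lemma power_bounded0 : power_bounded U e (fun=> 0).
Proof.
exists 1, 2^-1; split => [//||x _]; first lra.
by rewrite mul1r powR_ge0.
Qed.

Lemma power_boundedD {f g : X -> R} :
  power_bounded U e f -> power_bounded U e g ->
  power_bounded U e (fun x => f x + g x).
Proof.
move=> [C [a [C0 /andP[a0 a1] fC]]] [D [b [D0 /andP[b0 b1] gD]]].
(* Both exponents are lowered to a common one; each constant absorbs a power of [M]. *)
set m := Num.min a b.
have m0 : 0 < m by rewrite lt_min a0.
exists (C * M `^ (a - m) + D * M `^ (b - m)), m; split.
- by rewrite addr_gt0 ?mulr_gt0 ?powR_gt0.
- by rewrite m0 gt_min a1.
- move=> x Ux; rewrite mulrDl -!mulrA lerD //.
  + apply: le_trans (fC x Ux) _; rewrite ler_wpM2l ?(ltW C0)//.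
    by apply: powR_le_exponent; rewrite ?e_bounded// m0 ge_min lexx.
  + apply: le_trans (gD x Ux) _; rewrite ler_wpM2l ?(ltW D0)//.
    by apply: powR_le_exponent; rewrite ?e_bounded// m0 ge_min lexx orbT.
Qed.

Lemma power_boundedZ {c : R} {f : X -> R} : 0 < c ->
  power_bounded U e f -> power_bounded U e (fun x => c * f x).
Proof.
move=> c0 [C [a [C0 a01 fC]]]; exists (c * C), a; split => [|//|x Ux].
  exact: mulr_gt0.
by rewrite -mulrA ler_wpM2l ?fC// ltW.
Qed.

Lemma power_bounded_powR {b : R} {f : X -> R} : 0 < b < 1 ->
  (forall x, U x -> 0 <= f x) ->
  power_bounded U e f -> power_bounded U e (fun x => f x `^ b).
Proof.
move=> /andP[b0 b1] f0 [C [a [C0 /andP[a0 a1] fC]]].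
exists (C `^ b), (a * b); split; first exact: powR_gt0.
- by rewrite mulr_gt0//= mulr_ilt1 // ltW.
- move=> x Ux; rewrite powRrM -powRM ?powR_ge0 ?(ltW C0)//.
  by rewrite ge0_ler_powR ?nnegrE ?f0 ?fC ?(ltW b0)// mulr_ge0 ?powR_ge0// ltW.
Qed.

(** A maximum of nonnegative terms is at most their sum. *)
Lemma power_bounded_bigmax (I : Type) (s : seq I) (f : I -> X -> R) :
  (forall i x, U x -> 0 <= f i x) -> (forall i, power_bounded U e (f i)) ->
  power_bounded U e (fun x => \big[Num.max/0]_(i <- s) f i x).
Proof.
move=> f0 fb; elim: s => [|i s IH].
  by apply: power_bounded_le power_bounded0 _ => x _; rewrite big_nil.
apply: power_bounded_le (power_boundedD (fb i) IH) _ => x Ux.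
have max0 : 0 <= \big[Num.max/0]_(j <- s) f j x.
  by elim/big_ind: _ => // [u v u0 _|j _]; rewrite ?le_max ?u0 ?f0.
by rewrite big_cons ge_max lerDl lerDr max0 f0.
Qed.

End PowerBound.

Section Dist.
Context {R : realType} {H : normedModType R}.

Lemma dist_le {x : H} {C : set H} {c : H} : C c -> dist x C <= `|x - c|.
Proof.
move=> Cc; apply: ge_inf; last by exists c.
by exists 0 => _ [d _ <-]; exact: normr_ge0.
Qed.

Lemma dist_ge0 (x : H) (C : set H) : 0 <= dist x C.
Proof.
(* The empty set is covered by the default value 0 of [inf]. *)
rewrite /dist; have [->|E0] := eqVneq [set `|x - c| | c in C] set0.
  by rewrite inf0.
by apply: lb_le_inf; [exact/set0P|move=> _ [c _ <-]].
Qed.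

Lemma dist_triangle (x y : H) {C : set H} :
  C !=set0 -> dist x C <= `|x - y| + dist y C.
Proof.
move=> [c0 Cc0]; rewrite -lerBlDl; apply: lb_le_inf.
  by exists `|y - c0|, c0.
move=> _ [c Cc <-]; rewrite lerBlDl; apply: le_trans (dist_le Cc) _.
exact: ler_distD.
Qed.

End Dist.

Section Composition.
Context {R : realType} {H : normedModType R} {I : Type}.
Context {rho : I -> R} {T : I -> H -> H}.
Hypothesis T_sqne : forall i, strongly_quasinonexpansive (rho i) (T i).

Local Notation iter_ops s x := (foldl (fun y i => T i y) x s).

Lemma iter_ops_quasinonexpansive (s : seq I) (p x : H) :
  (forall i, Fix (T i) p) -> `|iter_ops s x - p| <= `|x - p|.
Proof.
move=> Fp; elim: s x => [//|i s IH] x /=; apply: le_trans (IH _) _.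
have [rho0 /(_ x p (Fp i)) sq] := T_sqne i.
rewrite -(ler_pXn2r (n := 2)) ?nnegrE//; apply: le_trans sq.
by rewrite lerDl mulr_ge0 ?exprn_ge0// ltW.
Qed.

(** Prefix and suffix do not increase the distance to [p], so the decrease of its square in one step
    is at most the decrease over the whole pass. Factoring that difference of squares gives the
    right-hand side. *)
Lemma iter_ops_step_sqr_le (s1 s2 : seq I) (i : I) (p x : H) :
  (forall j, Fix (T j) p) ->
  rho i * `|iter_ops s1 x - T i (iter_ops s1 x)| ^+ 2 <=
  2 * `|x - p| * `|x - iter_ops (s1 ++ i :: s2) x|.
Proof.
move=> Fp; have := iter_ops_quasinonexpansive (s1 ++ i :: s2) p x Fp.
rewrite foldl_cat /=; set y := iter_ops s1 x; set w := iter_ops s2 (T i y).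
move=> wx.
have [_ /(_ y p (Fp i)) sq] := T_sqne i.
have yx : `|y - p| ^+ 2 <= `|x - p| ^+ 2.
  by rewrite lerXn2r ?nnegrE ?iter_ops_quasinonexpansive.
have wy : `|w - p| ^+ 2 <= `|T i y - p| ^+ 2.
  by rewrite lerXn2r ?nnegrE ?iter_ops_quasinonexpansive.
have xw : `|x - p| <= `|x - w| + `|w - p| by exact: ler_distD.
have diff : `|x - p| ^+ 2 - `|w - p| ^+ 2 <= 2 * `|x - p| * `|x - w|.
  rewrite subr_sqr mulrC; apply: ler_pM; rewrite ?subr_ge0 ?addr_ge0//.
    by rewrite mulr_natl mulr2n lerD2l.
  by rewrite lerBlDr.
lra.
Qed.

End Composition.

(* The real Hilbert space is a complete normed module H over a realType whose
   norm comes from the inner product ip. *)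
Theorem theorem4p10 (R : realType) (H : completeNormedModType R)
    (ip : {dot H for idfun}) (ip_norm : forall x : H, ip x x = `|x| ^+ 2)
    (n : nat) (n_gt0 : (0 < n)%N)
    (rho : 'I_n -> R) (T : 'I_n -> H -> H)
    (T_sqne : forall i, strongly_quasinonexpansive (rho i) (T i))
    (FixT : Fix (comp_ops T) = \bigcap_i Fix (T i))
    (FixT0 : \bigcap_i Fix (T i) !=set0)
    (z : H) (r : R) (z_fix : Fix (comp_ops T) z) (r_gt0 : 0 < r)
    (T_reg : forall i, holder_regular_op (T i) (closed_ball_ Num.norm z r))
    (FixT_reg : holder_regular_sets (fun i => Fix (T i))
                                    (closed_ball_ Num.norm z r)) :
  holder_regular_op (comp_ops T) (closed_ball_ Num.norm z r).
Proof.
set U := closed_ball_ _ z r; set S := comp_ops T.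
pose e x := `|x - S x|.
have Fz i : Fix (T i) z by move: z_fix; rewrite FixT; exact.
have ballE x : U x -> `|x - z| <= r by rewrite /U /closed_ball_ /= distrC.
have fejer s x := iter_ops_quasinonexpansive T_sqne s z x Fz.
have M_gt0 : 0 < 2 * r by rewrite mulr_gt0.
have e_bounded x : U x -> 0 <= e x <= 2 * r.
  move=> /ballE xr; rewrite normr_ge0 /=; apply: le_trans (ler_distD z _ _) _.
  by rewrite (distrC z) mulr_natl mulr2n lerD// (le_trans (fejer _ _)).
pose it s x := foldl (fun y i => T i y) x s.
have step s1 i s2 : enum 'I_n = s1 ++ i :: s2 ->
    power_bounded U e (fun x => `|it s1 x - T i (it s1 x)|).
  move=> enumE; have [rho0 _] := T_sqne i.
  (* Divide the squared estimate by [rho i], use [|x - z| <= r], and take square roots. *)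
  exists (Num.sqrt (2 * r / rho i)), 2^-1; split; first by rewrite sqrtr_gt0 divr_gt0.
    lra.
  move=> x Ux; rewrite powR12_sqrt ?normr_ge0// -sqrtrM ?(ltW (divr_gt0 _ _))//.
  rewrite -[X in X <= _]normr_id -sqrtr_sqr ler_wsqrtr// mulrAC ler_pdivlMr// mulrC.
  apply: le_trans (iter_ops_step_sqr_le T_sqne s1 s2 i z x Fz) _.
  rewrite /e /S /comp_ops enumE ler_wpM2r// ler_wpM2l//; exact: ballE.
have drift s1 s2 : enum 'I_n = s1 ++ s2 ->
    power_bounded U e (fun x => `|x - it s1 x|).
  (* The last index of the prefix moves to the suffix, so the induction stays within splittings of
     [enum 'I_n]. *)
  elim/last_ind: s1 s2 => [|s1 i IH] s2 enumE.
    by apply: power_bounded_le power_bounded0 _ => x _; rewrite /it /= subrr normr0.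
  rewrite cat_rcons in enumE.
  apply: power_bounded_le
    (power_boundedD M_gt0 e_bounded (IH _ enumE) (step _ _ _ enumE)) _ => x _.
  by rewrite /it foldl_rcons ler_distD.
have dist_Fix i : power_bounded U e (fun x => dist x (Fix (T i))).
  have [s1 [s2 enumE]] : exists s1 s2, enum 'I_n = s1 ++ i :: s2.
    by have := mem_enum 'I_n i; rewrite inE => /splitPr[s1 s2]; exists s1, s2.
  have [k [g [k0 g01 reg]]] := T_reg i.
  apply: power_bounded_le (power_boundedD M_gt0 e_bounded (drift _ _ enumE)
    (power_boundedZ k0 (power_bounded_powR g01 _ (step _ _ _ enumE)))) _ => // x Ux.
  apply: le_trans (dist_triangle _ (it s1 x) _) _; first by exists z.
  (* Regularity of [T i] is available only on [U]; the iterate stays there because it is no farther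
     from [z] than [x]. *)
  rewrite lerD2l; apply: reg; rewrite /U /closed_ball_ /= distrC.
  exact: le_trans (fejer _ _) (ballE _ Ux).
(* By [FixT], the distance to the intersection is the distance to [Fix S]. *)
have [t [th [t0 th01 reg]]] := FixT_reg; rewrite -FixT in reg.
apply: power_bounded_le (power_boundedZ t0 _) reg.
apply: (power_bounded_bigmax M_gt0 e_bounded) => [i x _|i].
  exact: powR_ge0.
by apply: power_bounded_powR => // x _; exact: dist_ge0.
Qed.
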